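(* Let $G$ be a finite nilpotent group such that $|\tau_e(G)|=4$. Then $\tau_e(G)$ is not an arithmetic progression.
   Context: For a finite group $G$, let $o(x)$ denote the order of $x\in G$, and define the equivalence relation $x\sim y \iff o(x)=o(y)$ on $G$. The same-order type $\tau_e(G)$ is the set of the sizes of the equivalence classes of $\sim$; that is, $\tau_e(G)$ is the set of positive integers of the form $|\{x\in G : o(x)=n\}|$, where $n$ runs over the orders of elements of $G$. It is a set, so equal sizes are counted once. A finite set of integers is called an arithmetic progression if its elements, listed in increasing order, form an arithmetic progression, i.e. consecutive elements differ by a constant $r$ (the ratio). *)

(* Defs.v *)
From HB Require Import structures.
From mathcomp Require Import all_boot all_fingroup all_solvable.
From mathcomp Require Import finmap.
Set Implicit Arguments.
Unset Strict Implicit.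
Unset Printing Implicit Defensive.

Definition same_order (gT : finGroupType) : rel gT :=
  fun x y => #[x]%g == #[y]%g.

(* An image in {fset nat}, so classes of equal size contribute one element. *)
Definition same_order_type (gT : finGroupType) (G : {set gT}) : {fset nat} :=
  [fset #|(C : {set gT})| | C in equivalence_partition (@same_order gT) G]%fset.

(* A ratio in nat is no restriction, as the elements are listed in increasing
   order. *)
Definition arithmetic_progression (A : {fset nat}) : Prop :=
  exists r : nat, sorted (fun a b : nat => b == a + r) (sort leq A).

(* Main.v *)
Require Import Defs.
From HB Require Import structures.
From mathcomp Require Import all_boot all_fingroup all_solvable.
From mathcomp Require Import finmap.
From mathcomp Require Import zify.
Set Implicit Arguments.
Unset Strict Implicit.
Unset Printing Implicit Defensive.

(** The argument is modulo 4. Write [N d] for the number of elements of order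
    [d] in [G]. Elements of order [d] come in packets of [totient d], the
    generators of a common cyclic subgroup, so [N d] is even for [d > 2]; the
    only odd sizes are [N 1 = 1] and possibly [N 2].

    An arithmetic progression of four terms containing the minimum 1 consists
    of [1], [1 + r], [1 + 2r] and [1 + 3r] with [r > 0]. An even [r] would give
    four odd sizes, so [r] is odd and [1 + 2r] has to be [N 2].

    If an odd prime [p] divided [#|G|], then nilpotency would give
    [N (2p) >= N 2 * N p >= (1 + 2r)(1 + r)], which exceeds [1 + 3r]. So [G] is
    a 2-group, and every other size is [N (2 ^ k)] with [k >= 2]. All of these
    are divisible by 4: for [k >= 3] because [totient (2 ^ k)] is, and for
    [k = 2] because Frobenius' theorem makes the number [1 + N 2 + N 4] of
    solutions of [x ^ 4 = 1] divisible by 4, while [1 + N 2 = 2 (1 + r)] is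
    already so. But [1 + r] and [1 + 3r] differ by [2r], which is 2 modulo 4. *)

Definition elements_of_order (gT : finGroupType) (G : {set gT}) (n : nat) :
  {set gT} := [set x in G | #[x]%g == n].

Lemma even_totient n : 2 < n -> 2 %| totient n.
Proof.
move=> n_gt2; have n_gt0 : 0 < n by apply: ltn_trans n_gt2.
have [/p_natP[k def_n] | ] := boolP (2.-nat n).
  case: k def_n n_gt2 => [|[|k]] -> // _.
  by rewrite totient_pfactor // mul1n expnS dvdn_mulr.
rewrite /pnat n_gt0 => /allPn[q]; rewrite mem_primes => /and3P[q_pr _ q_dv] q2.
have [m co_qm def_n] := pfactor_coprime q_pr n_gt0.
have q_odd : odd q by case: (even_prime q_pr) q2 => [->|].
rewrite def_n totient_coprime 1?coprime_sym ?coprimeXl //.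
rewrite totient_pfactor -?pfactor_dvdn // dvdn_mull // dvdn_mulr // dvdn2.
by case: q q_pr q_odd {q_dv q2 co_qm def_n}.
Qed.

Section ElementsOfOrder.

Variables (gT : finGroupType) (G : {group gT}).
Implicit Types (x y : gT) (c m n : nat).

Lemma same_order_typeP c :
  reflect (exists2 x, x \in G & c = #|elements_of_order G #[x]%g|)
          (c \in same_order_type G).
Proof.
apply: (iffP (imfsetP _ _ _ _)) => [[C] | [x Gx ->]].
  rewrite /= => /imsetP[x Gx ->] ->; exists x => //.
  by apply: eq_card => y; rewrite !inE /same_order eq_sym.
exists [set y in G | same_order x y]; first exact: imset_f.
by apply: eq_card => y; rewrite !inE /same_order eq_sym.
Qed.

Lemma elements_of_order1 : elements_of_order G 1 = [set 1%g].
Proof.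
apply/setP=> x; rewrite !inE order_eq1.
by case: eqP => [->|_]; rewrite ?group1 ?andbF.
Qed.

(** The elements of order [n] are partitioned by the cyclic subgroup that they
    generate, and each block consists of the [totient n] generators of one
    cyclic group of order [n]. *)
Lemma totient_dvd_card_elements_of_order n :
  totient n %| #|elements_of_order G n|.
Proof.
set S := elements_of_order G n.
have uniS : {in preim_partition (@cycle gT) S, forall A : {set gT}, #|A| = totient n}.
  move=> A /imsetP[x]; rewrite inE => /andP[Gx /eqP ox] ->.
  rewrite -ox totient_gen; apply: eq_card => y; rewrite !inE /generator.
  apply/andP/idP=> [[]//|eq_xy]; rewrite eq_xy; split=> //.
  by rewrite -cycle_subG -(eqP eq_xy) cycle_subG Gx /= /order -(eqP eq_xy) -ox.
by rewrite (card_uniform_partition uniS (preim_partitionP _ _)) dvdn_mull.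
Qed.

Lemma even_card_elements_of_order n :
  2 < n -> ~~ odd #|elements_of_order G n|.
Proof.
move=> n_gt2; rewrite -dvdn2.
exact: dvdn_trans (even_totient n_gt2) (totient_dvd_card_elements_of_order n).
Qed.

(** In a nilpotent group elements of coprime orders commute, and a product
    [x * y] of such elements determines both of its factors as powers of it
    (its constituents at the primes of [m] and away from them). *)
Lemma leq_card_elements_of_order_coprime m n :
  nilpotent G -> 0 < m -> coprime m n ->
  #|elements_of_order G m| * #|elements_of_order G n|
    <= #|elements_of_order G (m * n)|.
Proof.
move=> nilG m_gt0 co_mn.
set A := elements_of_order G m; set B := elements_of_order G n.
have comAB x y : x \in A -> y \in B -> commute x y.
  rewrite !inE => /andP[Gx /eqP ox] /andP[Gy /eqP oy].
  apply/commute_sym/cent1P; rewrite -cent_cycle -cycle_subG.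
  by apply: sub_nilpotent_cent2 nilG _ _ _; rewrite ?cycle_subG // -!orderE ox oy.
have pi_part x y : x \in A -> y \in B -> ((x * y).`_\pi(m) = x)%g.
  move=> Ax By; rewrite consttM; last exact: comAB.
  move: Ax By; rewrite !inE => /andP[_ /eqP ox] /andP[_ /eqP oy].
  rewrite constt_p_elt; last by rewrite /p_elt ox pnat_pi.
  suff -> : (y.`_\pi(m) = 1)%g by rewrite mulg1.
  by apply/constt1P; rewrite /p_elt -coprime_pi' ?order_gt0 ?oy.
rewrite -cardsX -(card_in_imset (f := fun u : gT * gT => (u.1 * u.2)%g)).
  apply/subset_leq_card/subsetP=> _ /imsetP[[x y] /setXP[/= Ax By] ->].
  have cxy := comAB x y Ax By.
  move: Ax By; rewrite !inE => /andP[Gx /eqP ox] /andP[Gy /eqP oy].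
  by rewrite groupM //= orderM ?ox ?oy.
move=> [x y] [x' y'] /setXP[/= Ax By] /setXP[/= Ax' By'] eq_xy.
have eq_x : x = x' by rewrite -(pi_part x y) // eq_xy pi_part.
by move: eq_xy; rewrite eq_x => /mulgI->.
Qed.

(** The solutions of [x ^ 4 = 1] are the elements of order 1, 2 and 4, and
    Frobenius' theorem counts them modulo 4. *)
Lemma Frobenius_elements_of_order4 :
  4 %| #|G| ->
  4 %| 1 + #|elements_of_order G 2| + #|elements_of_order G 4|.
Proof.
move/Frobenius_Ldiv; congr (_ %| _).
set N := elements_of_order G.
have -> : 'Ldiv_4(G)%g = N 1 :|: N 2 :|: N 4.
  apply/setP=> x; rewrite !inE -order_dvdn -!andb_orr; congr (_ && _).
  rewrite -[RHS]orbA; apply/idP/or3P => [ |[]/eqP->//].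
  by case/(@dvdn_pfactor 2 _ 2 isT) => -[|[|[|//]]] _ ->;
    [exact: Or31 | exact: Or32 | exact: Or33].
have disjN m n : m != n -> N m :&: N n = set0.
  move=> neq_mn; apply/setP=> x; rewrite !inE; apply/negbTE.
  by apply: contra neq_mn => /andP[/andP[_ /eqP <-] /andP[_ /eqP <-]].
rewrite !cardsU setIUl !disjN // setU0 cards0 !subn0.
by rewrite /N elements_of_order1 cards1.
Qed.

(** In a 2-group [n] is a power of 2. The hypothesis on [N 2] makes [N 2] odd,
    so an even [N n] has [n >= 4]; Frobenius' theorem then settles [n = 4], and
    the divisor [totient n = n / 2] settles [n >= 8]. *)
Lemma dvd4_card_elements_of_order n :
  (2.-group G)%g -> 4 %| 1 + #|elements_of_order G 2| ->
  elements_of_order G n != set0 -> ~~ odd #|elements_of_order G n| ->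
  4 %| #|elements_of_order G n|.
Proof.
move=> pG dv2 /set0Pn[x] /setIdP[Gx /eqP ox].
have /p_natP[k def_n] : 2.-nat n by rewrite -ox; apply: mem_p_elt Gx.
rewrite def_n; case: k def_n => [|[|[|k]]] def_n evenN.
- by rewrite elements_of_order1 cards1 in evenN.
- have : odd (1 + #|elements_of_order G 2|) by rewrite oddD (negbTE evenN).
  by rewrite -[odd _]negbK -dvdn2 (dvdn_trans _ dv2).
- have /Frobenius_elements_of_order4 : 4 %| #|G|.
    by rewrite -[4]/(2 ^ 2) -def_n -ox order_dvdG.
  by rewrite dvdn_addr.
- apply: dvdn_trans (totient_dvd_card_elements_of_order _).
  by rewrite totient_pfactor // mul1n /= !expnS mulnA dvdn_mulr.
Qed.

End ElementsOfOrder.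

(** Since 0 is excluded, the member 1 has to be the smallest term. *)
Lemma four_term_progression (A : {fset nat}) :
  #|` A|%fset = 4 -> 1 \in A -> 0 \notin A -> arithmetic_progression A ->
  exists2 r, 0 < r & A =i [:: 1; 1 + r; 1 + 2 * r; 1 + 3 * r].
Proof.
move=> cardA A1 A0 [r].
have sizeA : size (sort leq A) = 4 by rewrite size_sort -cardA.
have : uniq (sort leq A) by rewrite sort_uniq fset_uniq.
have : sort leq A =i A by apply: mem_sort.
case: (sort leq A) sizeA => [|a [|b [|c [|d []]]]] // _ memA uniqA /=.
case/and4P=> /eqP def_b /eqP def_c /eqP def_d _.
move: uniqA; rewrite /= !inE !negb_or => uniqA.
have a1 : a = 1.
  move: A1 A0; rewrite -!memA !inE; lia.
exists r; first by lia.
move=> x; rewrite -memA !inE; lia.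
Qed.

Theorem theorem2p6 (gT : finGroupType) (G : {group gT}) :
  nilpotent G ->
  #|` same_order_type G|%fset = 4 ->
  ~ arithmetic_progression (same_order_type G).
Proof.
move=> nilG card4 AP; set N := fun n => #|elements_of_order G n|.
have type_pos c : c \in same_order_type G -> 0 < c.
  case/same_order_typeP=> x Gx ->.
  by apply/card_gt0P; exists x; rewrite inE Gx /=.
have type1 : 1 \in same_order_type G.
  apply/same_order_typeP; exists 1%g => //.
  by rewrite order1 elements_of_order1 cards1.
have [|r r_gt0 typeE] := four_term_progression card4 type1 _ AP.
  by apply/negP=> /type_pos.
have odd_type c : c \in same_order_type G -> odd c -> c = 1 \/ c = N 2.
  case/same_order_typeP=> x Gx def_c; rewrite {1}def_c => odd_c.
  have := contraL (@even_card_elements_of_order _ G #[x]%g) odd_c.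
  rewrite -leqNgt leq_eqVlt ltnS leq_eqVlt ltnNge order_gt0 orbF.
  case/orP=> /eqP ox; rewrite def_c ox; first by right.
  by left; rewrite elements_of_order1 cards1.
have type_terms : [/\ 1 + r \in same_order_type G, 1 + 2 * r \in same_order_type G
    & 1 + 3 * r \in same_order_type G].
  by rewrite !typeE !inE !eqxx !orbT.
have [type_r type_2r type_3r] := type_terms.
have N2 : N 2 = 1 + 2 * r.
  by case: (odd_type _ type_2r) => [||<-] //; lia.
have odd_r : odd r.
  apply/negPn/negP=> even_r.
  by case: (odd_type _ type_r); rewrite ?N2; lia.
have typeN x : x \in G -> N #[x]%g \in same_order_type G.
  by move=> Gx; apply/same_order_typeP; exists x.
have pG : (2.-group G)%g.
  apply/pgroupP=> p p_pr /(Cauchy p_pr)[x Gx ox]; rewrite inE /=.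
  apply/negPn/negP=> p2; have p_gt2 : 2 < p by case: p p_pr p2 {ox} => [|[|[]]].
  have Np : 1 + r <= N p.
    have := typeN x Gx; rewrite ox typeE !inE.
    have := even_card_elements_of_order G p_gt2; rewrite -/(N p); lia.
  (* This product is 1 + 3 * r + 2 * r ^ 2, larger than any term. *)
  have N2p : (1 + 2 * r) * (1 + r) <= N (2 * p).
    rewrite -N2; apply: leq_trans (leq_mul (leqnn _) Np) _.
    apply: leq_card_elements_of_order_coprime => //.
    by rewrite prime_coprime // dvdn_prime2 // eq_sym.
  have /card_gt0P[z] : 0 < N (2 * p) by apply: leq_trans N2p; lia.
  rewrite inE => /andP[Gz /eqP oz].
  by have := typeN z Gz; rewrite oz typeE !inE; nia.
have dvd4 c : c \in same_order_type G -> ~~ odd c -> 4 %| c.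
  case/same_order_typeP=> x Gx ->; apply: dvd4_card_elements_of_order => //.
    by rewrite -/(N 2) N2; lia.
  by apply/set0Pn; exists x; rewrite inE Gx /=.
(* Both 1 + r and 1 + 3 * r are even, but their difference is 2 modulo 4. *)
have /dvd4 := type_r; have /dvd4 := type_3r; lia.
Qed.
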